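(* Let $\mu>1$ be a real number. Then $$\zeta(\mu)\,\zeta(\mu+2)-\zeta(\mu+1)^2\ge 0.$$
   Context: $\zeta(s)=\sum_{n=1}^\infty n^{-s}$ ($s>1$) is the Riemann zeta function. *)

(* Defs.v *)
(* Stdlib real numbers with Coquelicot series. *)
From Stdlib Require Import Reals.
From Coquelicot Require Import Coquelicot.

Open Scope R_scope.

(* [Series] sums from index 0, hence the shift to [S n].  [zeta s] is the
   Riemann zeta function only for [1 < s], where the series converges; for
   other [s], [Series] returns an irrelevant default value. *)
Definition zeta (s : R) : R :=
  Series (fun n : nat => Rpower (INR (S n)) (- s)).

(* Main.v *)
(** Cauchy-Schwarz with the weights [n^-mu] and the function [1/n]:
    [zeta (mu + 1)] is its first moment and [zeta (mu + 2)] its second. *)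
Require Import Defs.
From Stdlib Require Import Reals Lra.
From Coquelicot Require Import Coquelicot.

Open Scope R_scope.

(** For every real $t$ the sum of $n^{-\mu}(t-1/n)^2$ is nonnegative. Expanded, it is the quadratic
    $\zeta(\mu)t^2-2\zeta(\mu+1)t+\zeta(\mu+2)$, so its discriminant is nonpositive, which is the
    claim ([discriminant_nonpos], [Series_Cauchy_Schwarz]). The expansion needs all three series to
    converge; [ex_series_zeta] gives this by comparing $n^{-(s+1)}$ with the telescoping differences
    of $n^{-s}/s$. *)

Lemma Series_nonneg (a : nat -> R) :
  (forall n, 0 <= a n) -> ex_series a -> 0 <= Series a.
Proof.
  intros ha ea.
  replace 0 with (Series (fun n => 0 * a n)) by (rewrite Series_scal_l; ring).
  apply Series_le; [|exact ea].
  intros n; specialize (ha n); lra.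
Qed.

(** For [A > 0], evaluate at the vertex [B / A]. The sign of [A] need not be given: a nonconstant
    line or a downward parabola would take negative values. *)
Lemma discriminant_nonpos (A B C : R) :
  (forall t, 0 <= A * t ^ 2 - 2 * B * t + C) -> B ^ 2 <= A * C.
Proof.
  intros h.
  destruct (Req_dec A 0) as [-> | hA].
  - destruct (Req_dec B 0) as [-> | hB]; [lra|].
    (* The point where the line [- 2 * B * t + C] takes the value -1. *)
    specialize (h ((C + 1) / (2 * B))).
    replace (0 * ((C + 1) / (2 * B)) ^ 2 - 2 * B * ((C + 1) / (2 * B)) + C)
      with (-1) in h by (field; exact hB).
    lra.
  - assert (hApos : 0 < A).
    { destruct (Rlt_le_dec 0 A) as [|hle]; [assumption|].
      exfalso.
      (* The parabola opens downwards, so its value at [B / A + x] is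
         negative for large [x]; this [x] is large enough. *)
      set (x := 1 + Rabs (C - B ^ 2 / A) / - A).
      assert (hd : 0 <= Rabs (C - B ^ 2 / A) / - A).
      { apply Rdiv_le_0_compat; [apply Rabs_pos | lra]. }
      specialize (h (B / A + x)).
      replace (A * (B / A + x) ^ 2 - 2 * B * (B / A + x) + C)
        with (A * x ^ 2 + (C - B ^ 2 / A)) in h by (field; exact hA).
      assert (hx : A * x = A - Rabs (C - B ^ 2 / A)).
      { unfold x; field; exact hA. }
      assert (hx1 : 1 <= x) by (unfold x; lra).
      pose proof (Rle_abs (C - B ^ 2 / A)) as hle'.
      pose proof (Rabs_pos (C - B ^ 2 / A)) as hge.
      replace (A * x ^ 2) with ((A * x) * x) in h by ring.
      rewrite hx in h.
      set (D := C - B ^ 2 / A) in *.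
      (* As [x >= 1], the value in [h] is at most [A - Rabs D + D <= A < 0]. *)
      assert (0 <= (Rabs D - A) * (x - 1)) by (apply Rmult_le_pos; lra).
      lra. }
    specialize (h (B / A)).
    apply (Rmult_le_compat_l A) in h; [|lra].
    replace (A * (A * (B / A) ^ 2 - 2 * B * (B / A) + C))
      with (A * C - B ^ 2) in h by (field; exact hA).
    lra.
Qed.

Lemma Series_Cauchy_Schwarz (a q : nat -> R) :
  (forall n, 0 <= a n) ->
  ex_series a ->
  ex_series (fun n => a n * q n) ->
  ex_series (fun n => a n * q n ^ 2) ->
  Series (fun n => a n * q n) ^ 2 <= Series a * Series (fun n => a n * q n ^ 2).
Proof.
  intros ha e0 e1 e2.
  apply discriminant_nonpos; intros t.
  (* Splitting the sum of [a n * (t - q n) ^ 2] into three series requires each to converge. *)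
  assert (f0 : ex_series (fun n => t ^ 2 * a n)).
  { exact (ex_series_scal (V := R_NormedModule) (t ^ 2) a e0). }
  assert (f1 : ex_series (fun n => 2 * t * (a n * q n))).
  { exact (ex_series_scal (V := R_NormedModule) (2 * t) _ e1). }
  assert (f01 : ex_series (fun n => t ^ 2 * a n - 2 * t * (a n * q n))).
  { exact (ex_series_minus _ _ f0 f1). }
  replace (Series a * t ^ 2 - 2 * Series (fun n => a n * q n) * t
           + Series (fun n => a n * q n ^ 2))
    with (Series (fun n => (t ^ 2 * a n - 2 * t * (a n * q n)) + a n * q n ^ 2)).
  - apply Series_nonneg.
    + intros n.
      replace (t ^ 2 * a n - 2 * t * (a n * q n) + a n * q n ^ 2)
        with (a n * (t - q n) ^ 2) by ring.
      apply Rmult_le_pos; [apply ha | apply pow2_ge_0].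
    + exact (ex_series_plus _ _ f01 e2).
  - rewrite Series_plus by assumption.
    rewrite Series_minus by assumption.
    rewrite !Series_scal_l; ring.
Qed.

Lemma Rpower_pos (x y : R) : 0 < Rpower x y.
Proof. apply exp_pos. Qed.

Lemma INR_S_pos (n : nat) : 0 < INR (S n).
Proof. apply lt_0_INR, Nat.lt_0_succ. Qed.

(* From [exp u >= 1 + u] and [- ln v >= 1 - v] with [v = x / (x + 1)]. *)
Lemma Rpower_telescope_le (s x : R) :
  0 < s -> 0 < x ->
  s * Rpower (x + 1) (- (s + 1)) <= Rpower x (- s) - Rpower (x + 1) (- s).
Proof.
  intros hs hx.
  assert (hy : Rpower (x + 1) (- (s + 1)) = Rpower (x + 1) (- s) * / (x + 1)).
  { replace (- (s + 1)) with (- s + - 1) by ring.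
    rewrite Rpower_plus, (Rpower_Ropp _ 1), Rpower_1 by lra; reflexivity. }
  assert (hxy : Rpower x (- s)
                = Rpower (x + 1) (- s) * exp (s * (ln (x + 1) - ln x))).
  { unfold Rpower; rewrite <- exp_plus; f_equal; ring. }
  assert (hln : / (x + 1) <= ln (x + 1) - ln x).
  { pose proof (exp_ineq1_le (ln x - ln (x + 1))) as h.
    unfold Rminus in h at 2.
    rewrite exp_plus, exp_Ropp, !exp_ln in h by lra.
    replace (x * / (x + 1)) with (1 - / (x + 1)) in h by (field; lra).
    lra. }
  pose proof (exp_ineq1_le (s * (ln (x + 1) - ln x))) as hexp.
  pose proof (Rpower_pos (x + 1) (- s)) as hp.
  apply (Rmult_le_compat_l s) in hln; [|lra].
  rewrite hy, hxy.
  (* With [L = ln (x + 1) - ln x], multiply [exp (s * L) - 1 >= s * L >= s / (x + 1)] by the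
     positive [Rpower (x + 1) (- s)]. *)
  nra.
Qed.

(** The terms are positive and telescoping bounds the partial sums, so these increase to a finite
    limit. *)
Lemma ex_series_zeta (mu : R) :
  1 < mu -> ex_series (fun n : nat => Rpower (INR (S n)) (- mu)).
Proof.
  intros hmu.
  set (s := mu - 1).
  assert (hs : 0 < s) by (unfold s; lra).
  (* The leading 1 is the term of index 0; the fraction is the telescoped bound for the others.
     Keeping its negative part lets the induction close. *)
  assert (hbound : forall n,
    sum_n (fun n : nat => Rpower (INR (S n)) (- mu)) n
    <= 1 + (1 - Rpower (INR (S n)) (- s)) / s).
  { induction n as [|n IH].
    - rewrite sum_O; simpl INR.
      unfold Rpower; rewrite ln_1, !Rmult_0_r, exp_0.
      replace ((1 - 1) / s) with 0 by (field; lra); lra.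
    - rewrite sum_Sn, (S_INR (S n)).
      change plus with Rplus.
      pose proof (Rpower_telescope_le s (INR (S n)) hs (INR_S_pos n)) as h.
      replace (- (s + 1)) with (- mu) in h by (unfold s; ring).
      apply (Rmult_le_compat_l (/ s)) in h;
        [|left; apply Rinv_0_lt_compat, hs].
      rewrite <- Rmult_assoc, Rinv_l, Rmult_1_l in h by lra.
      unfold Rdiv in *; lra. }
  destruct (ex_finite_lim_seq_incr
    (sum_n (fun n : nat => Rpower (INR (S n)) (- mu))) (1 + / s)) as [l hl].
  - intros n; rewrite sum_Sn; change plus with Rplus.
    pose proof (Rpower_pos (INR (S (S n))) (- mu)); lra.
  - intros n; eapply Rle_trans; [apply hbound|].
    pose proof (Rpower_pos (INR (S n)) (- s)).
    pose proof (Rinv_0_lt_compat s hs).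
    unfold Rdiv; nra.
  - exists l; exact hl.
Qed.

Theorem theorem6 (mu : R) (hmu : 1 < mu) :
  zeta mu * zeta (mu + 2) - zeta (mu + 1) ^ 2 >= 0.
Proof.
  assert (h1 : forall n, Rpower (INR (S n)) (- (mu + 1))
                         = Rpower (INR (S n)) (- mu) * / INR (S n)).
  { intros n; pose proof (INR_S_pos n).
    replace (- (mu + 1)) with (- mu + - 1) by ring.
    rewrite Rpower_plus, (Rpower_Ropp _ 1), Rpower_1 by assumption.
    reflexivity. }
  assert (h2 : forall n, Rpower (INR (S n)) (- (mu + 2))
                         = Rpower (INR (S n)) (- mu) * (/ INR (S n)) ^ 2).
  { intros n; pose proof (INR_S_pos n).
    replace (- (mu + 2)) with (- mu + - 1 + - 1) by ring.
    rewrite !Rpower_plus, (Rpower_Ropp _ 1), Rpower_1 by assumption.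
    ring. }
  unfold zeta.
  rewrite (Series_ext _ _ h1), (Series_ext _ _ h2).
  apply Rge_minus, Rle_ge.
  apply (Series_Cauchy_Schwarz _ (fun n => / INR (S n))).
  - intros n; left; apply Rpower_pos.
  - apply ex_series_zeta, hmu.
  (* The moment series are the zeta series at [mu + 1] and [mu + 2], whose exponents also exceed
     1. *)
  - apply (ex_series_ext _ _ h1), ex_series_zeta; lra.
  - apply (ex_series_ext _ _ h2), ex_series_zeta; lra.
Qed.
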